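(* Let $\mathfrak a$ and $\mathfrak h$ be quadratic Lie algebras and let $f:\mathfrak h\to{\rm Der}_{\rm quad}(\mathfrak a)$ be a homomorphism of quadratic Lie algebras. On the semi-direct product $\mathfrak a\times_f\mathfrak h$ (the graded vector space $\mathfrak a\times\mathfrak h$ with $n$-th component $\mathfrak a_n\times\mathfrak h_n$ and bracket $[(\xi,\sigma),(\xi',\sigma')]=([\xi,\xi']+f(\sigma)(\xi')+f(\sigma')(\xi),[\sigma,\sigma'])$), the map defined on elements of degree $1$ by $P(\xi,\sigma)=(P(\xi)+f(\sigma)(\xi),P(\sigma))$ defines the structure of a quadratic Lie algebra.
   Context: A quadratic Lie algebra is a graded Lie algebra $\mathfrak h=\bigoplus_{i\ge1}\mathfrak h_i$ over $\mathbb F_2$ together with a map $P:\mathfrak h_1\to\mathfrak h_2$ such that (QL1) $P(\xi+\eta)=P(\xi)+P(\eta)+[\xi,\eta]$ for $\xi,\eta$ of degree $1$, and (QL2) $[P\xi,\eta]=[\xi,[\xi,\eta]]$ for $\xi$ of degree $1$ and $\eta$ homogeneous. A homomorphism of quadratic Lie algebras is a graded Lie algebra homomorphism $f$ with $f(P(s))=P(f(s))$ for $s$ of degree $1$. A derivation of degree $s\ge1$ of a quadratic Lie algebra $\mathfrak h$ is an additive map $D$ with $D(\mathfrak h_n)\subseteq\mathfrak h_{n+s}$, $D(P(\xi))=[\xi,D(\xi)]$ for $\xi$ of degree $1$, and $D[\xi,\eta]=[D\xi,\eta]+[\xi,D\eta]$. ${\rm Der}_{\rm quad}(\mathfrak h)$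 is the graded vector space of such derivations (graded by degree), a quadratic Lie algebra with $[D_1,D_2]=D_1D_2+D_2D_1$ and $P(D)=D^2$ for $D$ of degree $1$. *)

(* Defs.v *)
From HB Require Import structures.
From mathcomp Require Import all_boot all_algebra.
From mathcomp Require Import boolp functions.

Set Implicit Arguments.
Unset Strict Implicit.
Unset Printing Implicit Defensive.

Import GRing.Theory.
Local Open Scope ring_scope.

(* V = \bigoplus_(n >= 1) V_n, where V_n = gr n.  The degrees start at 1, so   *)
(* every condition is restricted to n >= 1 and gr 0 plays no role.            *)
Record is_grading (V : lmodType 'F_2) (gr : nat -> {pred V}) : Prop := IsGrading {
  grading_submod : forall n, (1 <= n)%N -> GRing.submod_closed (gr n);
  grading_span : forall x : V, exists N (c : nat -> V),
    (forall n, (1 <= n)%N -> c n \in gr n) /\ x = \sum_(1 <= n < N) c n;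
  grading_free : forall N (c : nat -> V),
    (forall n, (1 <= n)%N -> c n \in gr n) -> \sum_(1 <= n < N) c n = 0 ->
    forall n, (1 <= n < N)%N -> c n = 0
}.

Record is_graded_lie (V : lmodType 'F_2) (gr : nat -> {pred V})
    (br : V -> V -> V) : Prop := IsGradedLie {
  lie_grading : is_grading gr;
  lie_linearl : forall y, linear (fun x => br x y);
  lie_linearr : forall x, linear (fun y => br x y);
  lie_alternating : forall x, br x x = 0;
  lie_jacobi : forall x y z,
    br x (br y z) + br y (br z x) + br z (br x y) = 0;
  lie_degree : forall i j x y, (1 <= i)%N -> (1 <= j)%N ->
    x \in gr i -> y \in gr j -> br x y \in gr (i + j)%N
}.

(* The map P : V_1 -> V_2 is represented by a function on all of V of which   *)
(* only the restriction to V_1 is constrained or used.                        *)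
Record is_quadratic_lie (V : lmodType 'F_2) (gr : nat -> {pred V})
    (br : V -> V -> V) (P : V -> V) : Prop := IsQuadraticLie {
  qlie_lie : is_graded_lie gr br;
  qlie_degree : forall x, x \in gr 1%N -> P x \in gr 2%N;
  qlie_QL1 : forall x y, x \in gr 1%N -> y \in gr 1%N ->
    P (x + y) = P x + P y + br x y;
  qlie_QL2 : forall n x y, (1 <= n)%N -> x \in gr 1%N -> y \in gr n ->
    br (P x) y = br x (br x y)
}.

Record quadraticLie : Type := QuadraticLie {
  qcarrier :> lmodType 'F_2;
  qgr : nat -> {pred qcarrier};
  qbr : qcarrier -> qcarrier -> qcarrier;
  qP : qcarrier -> qcarrier;
  qaxiom : is_quadratic_lie qgr qbr qP
}.

Record quadraticLieHom (g h : quadraticLie) : Type := QuadraticLieHom {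
  qhom_fun :> g -> h;
  qhom_linear : linear qhom_fun;
  qhom_degree : forall n x, (1 <= n)%N -> x \in qgr n -> qhom_fun x \in qgr n;
  qhom_br : forall x y, qhom_fun (qbr x y) = qbr (qhom_fun x) (qhom_fun y);
  qhom_P : forall x, x \in qgr 1%N -> qhom_fun (qP x) = qP (qhom_fun x)
}.

Record is_derivation (h : quadraticLie) (s : nat) (D : h -> h) : Prop :=
  IsDerivation {
  der_additive : zmod_morphism D;
  der_degree : forall n x, (1 <= n)%N -> x \in qgr n -> D x \in qgr (n + s)%N;
  der_P : forall x, x \in qgr 1%N -> D (qP x) = qbr x (D x);
  der_leibniz : forall x y, D (qbr x y) = qbr (D x) y + qbr x (D y)
}.

(* Der_quad(h) is the direct sum, inside the maps h -> h, of the spaces of     *)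
(* derivations of degree s >= 1: its elements are the finite sums of           *)
(* derivations, not only the homogeneous ones.                                 *)
Definition der_quad_pred (h : quadraticLie) : {pred h -> h} :=
  fun D => `[< exists N (c : nat -> h -> h),
    (forall s, (1 <= s)%N -> is_derivation s (c s)) /\
    D = \sum_(1 <= s < N) c s >].

Arguments der_quad_pred : clear implicits.

Lemma addF2 (V : lmodType 'F_2) (x : V) : x + x = 0.
Proof.
rewrite -[x]scale1r -scalerDl.
have -> : (1 + 1 : 'F_2) = 0 by apply/val_inj.
by rewrite scale0r.
Qed.

Lemma F2P (t : 'F_2) : t = 0 \/ t = 1.
Proof.
by case: t => [[|[|]]] // i; [left|right]; apply/val_inj.
Qed.

Section Derivations.
Variable h : quadraticLie.
Implicit Types (D E : h -> h) (x y : h).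

Let grL := lie_grading (qlie_lie (qaxiom h)).
Let lie := qlie_lie (qaxiom h).

Lemma qbrDl x y z : qbr (x + y) z = qbr x z + qbr y z :> h.
Proof. by have := lie_linearl lie z 1 x y; rewrite !scale1r. Qed.

Lemma qbrDr z x y : qbr z (x + y) = qbr z x + qbr z y :> h.
Proof. by have := lie_linearr lie z 1 x y; rewrite !scale1r. Qed.

Lemma qbr0l z : qbr 0 z = 0 :> h.
Proof. by have := qbrDl 0 0 z; rewrite addr0 addF2. Qed.

Lemma qbr0r z : qbr z 0 = 0 :> h.
Proof. by have := qbrDr z 0 0; rewrite addr0 addF2. Qed.

Lemma qgr0 n : (1 <= n)%N -> 0 \in @qgr h n.
Proof. by move=> /(grading_submod grL)[]. Qed.

Lemma qgrD n x y : (1 <= n)%N -> x \in qgr n -> y \in qgr n -> x + y \in qgr n.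
Proof.
move=> /(grading_submod grL)[_ cl] hx hy.
by have := cl 1 x y hx hy; rewrite scale1r.
Qed.

Lemma add_morphD D : zmod_morphism D -> {morph D : x y / x + y}.
Proof.
move=> aD x y; have oppF (z : h) : - z = z by apply/esym/eqP; rewrite -addr_eq0 addF2.
by have := aD x y; rewrite !oppF.
Qed.

Lemma zmod_morphD D : {morph D : x y / x + y} -> zmod_morphism D.
Proof.
move=> aD x y; have oppF (z : h) : - z = z by apply/esym/eqP; rewrite -addr_eq0 addF2.
by rewrite !oppF aD.
Qed.

Lemma add_morph0 D : zmod_morphism D -> D 0 = 0.
Proof. by move=> aD; rewrite -[0 in LHS](subrr 0) aD subrr. Qed.

Lemma qbrC x y : qbr x y = qbr y x :> h.
Proof.
have := lie_alternating lie (x + y).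
rewrite qbrDl !qbrDr !(lie_alternating lie) add0r addr0 => e.
by rewrite -[LHS]addr0 -(addF2 (qbr y x)) addrA e add0r.
Qed.

Lemma is_derivation0 s : (1 <= s)%N -> is_derivation s (0 : h -> h).
Proof.
move=> s1; split=> //=.
- by move=> x y /=; rewrite subrr.
- by move=> n x n1 _; rewrite qgr0 // addn_gt0 n1.
- by move=> x _ /=; rewrite qbr0r.
- by move=> x y /=; rewrite qbr0r qbr0l addr0.
Qed.

Lemma is_derivationD s D E : (1 <= s)%N ->
  is_derivation s D -> is_derivation s E -> is_derivation s (D + E).
Proof.
move=> s1 [aD dD pD bD] [aE dE pE bE]; split => /=.
- apply: zmod_morphD => x y /=; rewrite !fctE.
  by rewrite (add_morphD aD) (add_morphD aE) addrACA.
- move=> n x n1 hx; rewrite !fctE; apply: qgrD; first by rewrite addn_gt0 n1.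
    exact: dD.
  exact: dE.
- by move=> x hx; rewrite !fctE pD // pE // qbrDr.
- by move=> x y; rewrite !fctE bD bE qbrDl qbrDr addrACA.
Qed.

Definition der_br D E : h -> h := (D \o E) + (E \o D).

Lemma der_brE D E x : der_br D E x = D (E x) + E (D x).
Proof. by []. Qed.

Lemma is_derivation_br s t D E : is_derivation s D -> is_derivation t E ->
  is_derivation (s + t) (der_br D E).
Proof.
move=> [aD dD pD bD] [aE dE pE bE].
have {aD}aD := add_morphD aD; have {aE}aE := add_morphD aE.
split => /=.
- apply: zmod_morphD => x y /=; rewrite !der_brE.
  by rewrite aE aD (aD x) aE addrACA.
- move=> n x n1 hx; rewrite !der_brE; apply: qgrD.
  + by rewrite addn_gt0 n1.
  + rewrite [(s + t)%N]addnC addnA; apply: dD; last exact: dE.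
    by rewrite addn_gt0 n1.
  + rewrite addnA; apply: dE; last exact: dD.
    by rewrite addn_gt0 n1.
- move=> x hx; rewrite !der_brE pD // pE // bD bE qbrDr (qbrC (E x)).
  by rewrite (AC (2*2) ((1*3)*2*4)) /= addF2 add0r addrC.
- move=> x y; rewrite !der_brE bE bD aD aE !bD !bE !qbrDl !qbrDr.
  rewrite [LHS](AC ((2*2)*(2*2)) ((2*7)*(3*6)*(1*5)*(4*8))) /= !addF2 !add0r.
  by [].
Qed.

Lemma is_derivation_sq s D : is_derivation s D -> is_derivation (s + s) (D \o D).
Proof.
move=> [aD degD pD bD]; have {aD}aD := add_morphD aD; split => /=.
- by apply: zmod_morphD => x y /=; rewrite !aD.
- move=> n x n1 hx; rewrite addnA; apply: (degD); last exact: degD.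
  by rewrite addn_gt0 n1.
- by move=> x hx; rewrite pD // bD (lie_alternating lie) add0r.
- move=> x y; rewrite !bD aD !bD.
  by rewrite (AC (2*2) (1*(2*3)*4)) /= addF2 addr0.
Qed.

Lemma in_der_quad D : reflect (exists N (c : nat -> h -> h),
    (forall s, (1 <= s)%N -> is_derivation s (c s)) /\ D = \sum_(1 <= s < N) c s)
  (D \in der_quad_pred h).
Proof. exact: asboolP. Qed.

Lemma der_quad_hom s D : (1 <= s)%N -> is_derivation s D -> D \in der_quad_pred h.
Proof.
move=> s1 dD; apply/in_der_quad; exists s.+1, (fun i => if i == s then D else 0).
split=> [i i1|]; first by case: eqP => [->|_] //; exact: is_derivation0.
rewrite big_nat_recr //= eqxx big_nat big1 ?add0r // => i /andP[_ lis].
by rewrite ltn_eqF.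
Qed.

Lemma der_quad0 : 0 \in der_quad_pred h.
Proof. by apply: (@der_quad_hom 1) => //; exact: is_derivation0. Qed.

Lemma der_quadD D E : D \in der_quad_pred h -> E \in der_quad_pred h ->
  D + E \in der_quad_pred h.
Proof.
have pad (N M : nat) (c : nat -> h -> h) : (N <= M)%N ->
    \sum_(1 <= s < N) c s = \sum_(1 <= s < M) (if (s < N)%N then c s else 0).
  move=> NM; rewrite [RHS](big_nat_widenl _ 0) // [LHS](big_nat_widenl _ 0) //.
  rewrite (big_nat_widen _ _ M) // big_mkcondr /=.
  by apply: eq_bigr.
move=> /in_der_quad[N [c [dc ->]]] /in_der_quad[M [d [dd ->]]].
rewrite (pad N (maxn N M)) ?leq_maxl // (pad M (maxn N M)) ?leq_maxr //.
apply/in_der_quad; exists (maxn N M); rewrite -big_split /=.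
eexists (fun s => _); split; last by [].
move=> s s1 /=; apply: is_derivationD => //; case: ifP => _.
- exact: dc.
- exact: is_derivation0.
- exact: dd.
- exact: is_derivation0.
Qed.

Lemma der_quad_sum N (c : nat -> h -> h) :
  (forall s, (1 <= s)%N -> c s \in der_quad_pred h) ->
  \sum_(1 <= s < N) c s \in der_quad_pred h.
Proof.
move=> hc; rewrite big_nat; apply: (big_ind (fun D => D \in der_quad_pred h)).
- exact: der_quad0.
- exact: der_quadD.
- by move=> i /andP[i1 _]; apply: hc.
Qed.

Lemma der_quad_add D : D \in der_quad_pred h -> {morph D : x y / x + y}.
Proof.
move=> /in_der_quad[N [c [dc ->]]] x y; rewrite !fct_sumE -big_split /=.
rewrite big_nat [RHS]big_nat; apply: eq_bigr => s /andP[s1 _].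
exact: (add_morphD (der_additive (dc s s1))).
Qed.

Lemma add_morph_sum D N (c : nat -> h) : {morph D : x y / x + y} ->
  D (\sum_(1 <= s < N) c s) = \sum_(1 <= s < N) D (c s).
Proof.
move=> aD; apply: (big_morph D) => //.
by apply: (@addIr _ (D 0)); rewrite -aD !addr0 add0r.
Qed.

Lemma der_quad_br D E : D \in der_quad_pred h -> E \in der_quad_pred h ->
  der_br D E \in der_quad_pred h.
Proof.
move=> hD hE; have aD := der_quad_add hD; have aE := der_quad_add hE.
move: hD hE => /in_der_quad[N [c [dc eD]]] /in_der_quad[M [d [dd eE]]].
have -> : der_br D E =
    \sum_(1 <= s < N) \sum_(1 <= t < M) der_br (c s) (d t).
  apply/funext => x; rewrite der_brE fct_sumE.
  have eDx y : D y = \sum_(1 <= s < N) c s y by rewrite eD fct_sumE.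
  have eEx y : E y = \sum_(1 <= t < M) d t y by rewrite eE fct_sumE.
  rewrite (eDx (E x)) (eDx x) (add_morph_sum _ _ aE) -big_split /=.
  rewrite big_nat [RHS]big_nat; apply: eq_bigr => s /andP[s1 _].
  have acs := add_morphD (der_additive (dc s s1)).
  by rewrite fct_sumE (eEx (c s x)) (eEx x) (add_morph_sum _ _ acs) -big_split.
apply: der_quad_sum => s s1; apply: der_quad_sum => t t1.
apply: (@der_quad_hom (s + t)); first by rewrite addn_gt0 s1.
exact: is_derivation_br (dc s s1) (dd t t1).
Qed.

Lemma der_quad_sq D : D \in der_quad_pred h -> D \o D \in der_quad_pred h.
Proof.
move=> hD; case/in_der_quad: (hD) => N [c [dc eD]]; rewrite {}eD {hD}.
have hc s : (1 <= s)%N -> c s \in der_quad_pred h.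
  by move=> s1; apply: (@der_quad_hom s) => //; apply: dc.
elim: N => [|N IH].
  by rewrite big_geq //; exact: der_quad0.
case: N IH => [|N] IH; first by rewrite big_geq //; exact: der_quad0.
rewrite big_nat_recr //=; set S := \sum_(_ <= _ < _) _ in IH *.
have hS : S \in der_quad_pred h by exact: der_quad_sum.
have aS := der_quad_add hS; have aN := der_quad_add (hc N.+1 isT).
have -> : (S + c N.+1) \o (S + c N.+1) =
    (S \o S) + der_br S (c N.+1) + (c N.+1 \o c N.+1).
  apply/funext => x; rewrite /= !fctE /= aS aN der_brE.
  by rewrite !addrA.
apply: der_quadD; last first.
  apply: (@der_quad_hom (N.+1 + N.+1)) => //.
  exact: is_derivation_sq (dc _ _).
apply: der_quadD; first exact: IH.
by apply: der_quad_br => //; apply: hc.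
Qed.

Lemma der_quad_submod : GRing.submod_closed (der_quad_pred h).
Proof.
split; first exact: der_quad0.
move=> t D E hD hE; apply: der_quadD => //.
by case: (F2P t) => ->; rewrite ?scale0r ?scale1r //; exact: der_quad0.
Qed.

End Derivations.

HB.instance Definition _ (h : quadraticLie) :=
  GRing.isSubmodClosed.Build 'F_2 (h -> h) (der_quad_pred h) (der_quad_submod h).

Record derQuad (h : quadraticLie) : Type := DerQuad {
  derQuad_fun :> h -> h;
  derQuad_in : derQuad_fun \in der_quad_pred h
}.

HB.instance Definition _ (h : quadraticLie) := [isSub for @derQuad_fun h].
HB.instance Definition _ (h : quadraticLie) := [Choice of derQuad h by <:].
HB.instance Definition _ (h : quadraticLie) :=
  [SubChoice_isSubLmodule of derQuad h by <:].

Section DerQuad.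
Variable h : quadraticLie.

Definition derQuad_gr (s : nat) : {pred derQuad h} :=
  fun D => `[< is_derivation s (D : h -> h) >].

Definition derQuad_br (D E : derQuad h) : derQuad h :=
  DerQuad (der_quad_br (derQuad_in D) (derQuad_in E)).

Definition derQuad_P (D : derQuad h) : derQuad h :=
  DerQuad (der_quad_sq (derQuad_in D)).

Lemma derQuad_inj (D E : derQuad h) : (D : h -> h) = E -> D = E.
Proof. exact: val_inj. Qed.

Lemma derQuadP (D E : derQuad h) : (forall x, D x = E x) -> D = E.
Proof. by move=> e; apply/val_inj/funext. Qed.

Lemma derQuad_addE (D E : derQuad h) x : (D + E) x = D x + E x.
Proof. by []. Qed.

Lemma derQuad_brE (D E : derQuad h) x : derQuad_br D E x = D (E x) + E (D x).
Proof. by []. Qed.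

Lemma derQuad_PE (D : derQuad h) x : derQuad_P D x = D (D x).
Proof. by []. Qed.

Lemma derQuad_sumE N (c : nat -> derQuad h) :
  (\sum_(1 <= s < N) c s : h -> h) = \sum_(1 <= s < N) (c s : h -> h).
Proof. exact: (raddf_sum (val : derQuad h -> (h -> h))). Qed.

Lemma derQuadDx (D : derQuad h) : {morph D : x y / x + y}.
Proof. exact: der_quad_add (derQuad_in D). Qed.

Lemma derQuad_linear1 (V : lmodType 'F_2) (g : V -> V) :
  {morph g : x y / x + y} -> linear g.
Proof.
move=> gD t x y; rewrite gD; congr (_ + _).
case: (F2P t) => ->; rewrite ?scale1r // !scale0r.
by apply: (@addIr _ (g 0)); rewrite -gD !add0r.
Qed.

Lemma derQuad_grading : is_grading derQuad_gr.
Proof.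
split.
- move=> s s1; split; first by apply/asboolP; exact: is_derivation0.
  move=> t D E /asboolP hD /asboolP hE; apply/asboolP.
  case: (F2P t) => ->; rewrite ?scale0r ?scale1r ?add0r //.
  exact: is_derivationD.
- move=> D; have /in_der_quad[N [c [hc eD]]] := derQuad_in D.
  exists N, (fun s => insubd 0 (c s)).
  have cE s : (1 <= s)%N -> (insubd (0 : derQuad h) (c s) : h -> h) = c s.
    by move=> s1; apply: (@insubdK _ _ (derQuad h)); exact: der_quad_hom (hc _ s1).
  split; first by move=> s s1; apply/asboolP; rewrite cE //; exact: hc.
  apply: derQuad_inj; rewrite [LHS]eD derQuad_sumE.
  by rewrite big_nat [RHS]big_nat; apply: eq_bigr => s /andP[s1 _]; rewrite cE.
- move=> N c hc e s /andP[s1 sN]; apply: derQuadP => y.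
  have hc' t : (1 <= t)%N -> is_derivation t (c t : h -> h) by move=> /hc/asboolP.
  have grL := lie_grading (qlie_lie (qaxiom h)).
  have [M [d [hd ->]]] := grading_span grL y.
  rewrite add_morph_sum; last exact: derQuadDx.
  rewrite [RHS](_ : _ = 0) // big_nat big1 // => n /andP[n1 _].
  pose b m := if ((n + 1 <= m) && (m < n + N))%N then c (m - n)%N (d n) else 0.
  have hb m : (1 <= m)%N -> b m \in qgr m.
    rewrite /b; case: ifP => [/andP[nm mN] m1|_ m1]; last exact: qgr0.
    have m_n : (1 <= m - n)%N by rewrite subn_gt0 -addn1.
    have := der_degree (hc' _ m_n) n1 (hd _ n1).
    by rewrite subnKC // ltnW // -addn1.
  have sb : \sum_(1 <= m < n + N) b m = 0.
    have := congr1 (fun D : derQuad h => (D : h -> h) (d n)) e.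
    rewrite /= derQuad_sumE fct_sumE => e'; rewrite -[RHS]e'.
    rewrite (@big_cat_nat _ _ _ n.+1) //=; last first.
      by rewrite -addn1 leq_add2l (leq_ltn_trans _ sN).
    rewrite big_nat big1 ?add0r => [|m /andP[_ mn]]; last first.
      by rewrite /b addn1 leqNgt mn.
    rewrite -[n.+1]add1n big_addn.
    have -> : (n + N - n = N)%N by rewrite addKn.
    rewrite big_nat [RHS]big_nat; apply: eq_bigr => m /andP[m1 mN].
    by rewrite /b [(m + n)%N]addnC leq_add2l m1 ltn_add2l mN addKn.
  have := grading_free grL hb sb (n := (n + s)%N).
  by rewrite /b addn_gt0 n1 leq_add2l s1 ltn_add2l sN addKn /=; apply.
Qed.

Lemma derQuad_axiom : is_quadratic_lie derQuad_gr derQuad_br derQuad_P.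
Proof.
have grD (s : nat) (D : derQuad h) : D \in derQuad_gr s -> is_derivation s (D : h -> h).
  by move=> /asboolP.
split; first split.
- exact: derQuad_grading.
- move=> E; apply: derQuad_linear1 => D1 D2; apply: derQuadP => x.
  by rewrite !(derQuad_brE, derQuad_addE) derQuadDx addrACA.
- move=> E; apply: derQuad_linear1 => D1 D2; apply: derQuadP => x.
  by rewrite !(derQuad_brE, derQuad_addE) derQuadDx addrACA.
- by move=> D; apply: derQuadP => x; rewrite derQuad_brE addF2.
- move=> D E F; apply: derQuadP => x.
  rewrite !(derQuad_brE, derQuad_addE) !derQuadDx.
  rewrite [LHS](AC (((2*2)*(2*2))*(2*2))
    ((1*11)*(2*8)*(3*5)*(4*10)*(6*12)*(7*9))) /=.
  by rewrite !(addF2, addr0).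
- move=> i j D E i1 j1 /grD hD /grD hE; apply/asboolP.
  exact: is_derivation_br.
- by move=> D /grD hD; apply/asboolP; exact: (is_derivation_sq hD).
- move=> D E _ _; apply: derQuadP => x.
  rewrite !(derQuad_brE, derQuad_addE, derQuad_PE) !derQuadDx.
  by rewrite (AC (2*2) (1*4*(2*3))).
- move=> n D E _ _ _; apply: derQuadP => x.
  rewrite !(derQuad_brE, derQuad_PE) derQuadDx.
  by rewrite (AC (2*2) (1*4*(2*3))) /= addF2 addr0.
Qed.

Definition Der_quad : quadraticLie := QuadraticLie derQuad_axiom.

End DerQuad.

Section SemiDirect.
Variables (a h : quadraticLie) (f : quadraticLieHom h (Der_quad a)).

Definition semidirect_gr (n : nat) : {pred (a * h)%type} :=
  fun u => (u.1 \in qgr n) && (u.2 \in qgr n).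

Definition semidirect_br (u v : a * h) : a * h :=
  (qbr u.1 v.1 + (f u.2 : derQuad a) v.1 + (f v.2 : derQuad a) u.1,
   qbr u.2 v.2).

Definition semidirect_P (u : a * h) : a * h :=
  (qP u.1 + (f u.2 : derQuad a) u.1, qP u.2).

End SemiDirect.

(* Main.v *)
(* Every identity is checked on components: the second one is the identity in  *)
(* h, and in the first one the terms not accounted for in a cancel in pairs,   *)
(* the characteristic being 2.  The first component of QL2 uses that f t, for  *)
(* t of degree n, is a derivation compatible with P, so that                   *)
(* f t (P x) = [x, f t x].  Jacobi holds for all elements, not only            *)
(* homogeneous ones, so it needs the Leibniz rule for sums of derivations.     *)
Require Import Defs.
From mathcomp Require Import all_boot all_algebra.
From mathcomp Require Import boolp functions.

Set Implicit Arguments.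
Unset Strict Implicit.
Unset Printing Implicit Defensive.

Import GRing.Theory.
Local Open Scope ring_scope.

(** Through [f], the algebra [h] acts on [a], and each property of this action answers for part of
    an axiom. Jacobi follows from the Leibniz rule and [f [s, t] = f s f t + f t f s]. QL1 follows
    from biadditivity of the action: the cross terms [[x, y] + f s y + f t x] of [P] are the first
    component of the bracket. QL2 uses in addition [f (P s) = (f s)^2] and the compatibility of
    [f t] with [P]. The grading is checked on each factor. *)

Lemma derQuad_leibniz (h : quadraticLie) (D : derQuad h) (x y : h) :
  D (qbr x y) = qbr (D x) y + qbr x (D y).
Proof.
(* [D] need not be homogeneous, but the Leibniz rule is additive in [D], so it is checked on each
   homogeneous summand. *)
have [N [c [dc eD]]] := in_der_quad _ (derQuad_in D).
rewrite eD !fct_sumE.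
rewrite (big_morph (fun z => qbr z y) (fun u v => qbrDl u v y) (qbr0l y)).
rewrite (big_morph (qbr x) (qbrDr x) (qbr0r x)) -big_split /=.
rewrite big_nat [RHS]big_nat; apply: eq_bigr => s /andP[s1 _].
exact: der_leibniz (dc s s1) x y.
Qed.

(** Padding with zeros frees the bound [N], so that an element of [a] and one of [h] can be
    decomposed over the same range. *)
Lemma grading_span_le (V : lmodType 'F_2) (gr : nat -> {pred V}) (x : V) :
  is_grading gr -> exists N, forall M, (N <= M)%N -> exists c : nat -> V,
    (forall n, (1 <= n)%N -> c n \in gr n) /\ x = \sum_(1 <= n < M) c n.
Proof.
move=> grV; have [N [c [hc ->]]] := grading_span grV x; exists N => M NM.
exists (fun n => if (n < N)%N then c n else 0); split=> [n n1|].
  by case: ifP => _; [apply: hc | have [] := grading_submod grV n1].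
by rewrite (big_nat_widen _ _ M) // big_mkcond.
Qed.

Lemma semidirect_grading (a h : quadraticLie) : is_grading (@semidirect_gr a h).
Proof.
have gra := lie_grading (qlie_lie (qaxiom a)).
have grh := lie_grading (qlie_lie (qaxiom h)).
split.
- move=> n n1; have [a0 aZ] := grading_submod gra n1.
  have [h0 hZ] := grading_submod grh n1.
  split; first by apply/andP.
  move=> t u v /andP[u1 u2] /andP[v1 v2].
  by apply/andP; split; [apply: aZ | apply: hZ].
- move=> [x s].
  have [N hN] := grading_span_le x gra; have [M hM] := grading_span_le s grh.
  have [c [hc ->]] := hN _ (leq_maxl N M); have [d [hd ->]] := hM _ (leq_maxr N M).
  exists (maxn N M), (fun n => (c n, d n)); split=> [n n1|].
    by apply/andP; split; [apply: hc | apply: hd].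
  by rewrite [LHS]surjective_pairing [RHS]surjective_pairing /= !raddf_sum.
- move=> N c hc e n nN.
  have e1 := congr1 fst e; have e2 := congr1 snd e.
  rewrite raddf_sum in e1; rewrite raddf_sum in e2.
  rewrite [c n]surjective_pairing.
  rewrite (grading_free gra (c := fun n => (c n).1) _ e1 nN); last first.
    by move=> m /hc/andP[].
  rewrite (grading_free grh (c := fun n => (c n).2) _ e2 nN) //.
  by move=> m /hc/andP[].
Qed.

Section SemiDirect.
Variables (a h : quadraticLie) (f : quadraticLieHom h (Der_quad a)).
Implicit Types (x y z : a) (s t r : h).

(** Viewing [f s] as a plain map turns the properties of [f] into rewriting rules for an action. *)
Definition semidirect_act s : a -> a := (f s : derQuad a).
Local Notation act := semidirect_act.

Lemma act_addr s x y : act s (x + y) = act s x + act s y.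
Proof. exact: derQuadDx. Qed.

Lemma act_addl s t x : act (s + t) x = act s x + act t x.
Proof.
rewrite /act; have := qhom_linear f 1 s t; rewrite !scale1r => ->.
exact: derQuad_addE.
Qed.

Lemma act_br s t x : act (qbr s t) x = act s (act t x) + act t (act s x).
Proof. by rewrite /act qhom_br. Qed.

Lemma act_sq s x : s \in qgr 1%N -> act (qP s) x = act s (act s x).
Proof. by move=> s1; rewrite /act qhom_P. Qed.

Lemma act_leibniz s x y : act s (qbr x y) = qbr (act s x) y + qbr x (act s y).
Proof. exact: derQuad_leibniz. Qed.

Lemma act_derivation n s : (1 <= n)%N -> s \in qgr n -> is_derivation n (act s).
Proof. by move=> n1 /(qhom_degree f n1)/asboolP. Qed.

(** No sign appears in characteristic 2; by this symmetry linearity on the right suffices. *)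
Lemma semidirect_brC u v : semidirect_br f u v = semidirect_br f v u.
Proof. by rewrite /semidirect_br (qbrC u.1) (qbrC u.2) addrAC. Qed.

Lemma semidirect_linearr u : linear (semidirect_br f u).
Proof.
apply: derQuad_linear1 => -[y t] [z r]; congr pair => /=; last exact: qbrDr.
rewrite qbrDr -!/(act _ _) act_addr act_addl.
by rewrite (AC (2*2*2) ((1*3*5)*(2*4*6))).
Qed.

Lemma semidirect_jacobi u v w :
  semidirect_br f u (semidirect_br f v w) +
  semidirect_br f v (semidirect_br f w u) +
  semidirect_br f w (semidirect_br f u v) = 0.
Proof.
case: u v w => [x s] [y t] [z r]; congr pair => /=; last first.
  exact: lie_jacobi (qlie_lie (qaxiom h)) s t r.
rewrite -!/(act _ _) !(qbrDr, act_addr, act_leibniz, act_br).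
rewrite (qbrC (act s y)) (qbrC (act t z)) (qbrC (act r x)).
(* Of the 27 terms, [1*10*19] is the Jacobi sum in [a]. The other 24 cancel in pairs: six pairs of
   the form [[x, f t z]] by Leibniz, six of the form [f s (f t z)] from the action of a bracket. *)
rewrite [LHS](AC ((3*4*2)*(3*4*2)*(3*4*2))
  ((1*10*19)*(2*13)*(3*23)*(4*20)*(5*12)*(6*26)*(7*18)*(8*15)*(9*25)*(11*22)
   *(14*21)*(16*27)*(17*24))) /= !addF2 !addr0.
exact: lie_jacobi (qlie_lie (qaxiom a)) x y z.
Qed.

Lemma semidirect_QL2 x s y t n : (1 <= n)%N ->
  x \in qgr 1%N -> s \in qgr 1%N -> t \in qgr n -> y \in qgr n ->
  semidirect_br f (semidirect_P f (x, s)) (y, t) =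
  semidirect_br f (x, s) (semidirect_br f (x, s) (y, t)).
Proof.
move=> n1 x1 s1 tn yn; congr pair => /=; last exact: (qlie_QL2 (qaxiom h) n1).
rewrite -!/(act _ _) qbrDl !qbrDr !act_addr act_br act_sq // act_leibniz.
rewrite (der_P (act_derivation n1 tn)) // (qlie_QL2 (qaxiom a) n1) //.
(* On the right, [[x, f s y]] and [f s (f t x)] each occur twice and cancel; the rest is the left
   side. *)
rewrite [RHS](AC (3*4*2) ((1*4*6*(3*9))*(2*5)*(7*8))) /=.
by rewrite !addF2 !addr0.
Qed.

Lemma semidirect_degree i j u v : (1 <= i)%N -> (1 <= j)%N ->
  u \in @semidirect_gr a h i -> v \in @semidirect_gr a h j ->
  semidirect_br f u v \in @semidirect_gr a h (i + j).
Proof.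
move=> i1 j1 /andP[u1 u2] /andP[v1 v2].
have ij : (1 <= i + j)%N by rewrite addn_gt0 i1.
apply/andP; split; last exact: (lie_degree (qlie_lie (qaxiom h)) i1 j1).
apply: qgrD => //; first apply: qgrD => //.
- exact: (lie_degree (qlie_lie (qaxiom a)) i1 j1).
- by rewrite addnC; exact: (der_degree (act_derivation i1 u2) j1).
- exact: (der_degree (act_derivation j1 v2) i1).
Qed.

Lemma semidirect_P_degree u : u \in @semidirect_gr a h 1 ->
  semidirect_P f u \in @semidirect_gr a h 2.
Proof.
move=> /andP[u1 u2]; apply/andP; split; last exact: (qlie_degree (qaxiom h)).
apply: qgrD => //; first exact: (qlie_degree (qaxiom a)).
exact: (der_degree (act_derivation (leqnn 1) u2) (leqnn 1)).
Qed.

Lemma semidirect_QL1 u v :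
  u \in @semidirect_gr a h 1 -> v \in @semidirect_gr a h 1 ->
  semidirect_P f (u + v) =
  semidirect_P f u + semidirect_P f v + semidirect_br f u v.
Proof.
case: u v => [x s] [y t] /andP[/= x1 s1] /andP[/= y1 t1].
congr pair => /=; last exact: (qlie_QL1 (qaxiom h)).
rewrite -!/(act _ _) (qlie_QL1 (qaxiom a)) // act_addr !act_addl.
by rewrite [LHS](AC (3*(2*2)) ((1*4)*(2*7)*(3*6*5))).
Qed.

End SemiDirect.

Theorem theorem3p3 (a h : quadraticLie) (f : quadraticLieHom h (Der_quad a)) :
  is_quadratic_lie (@semidirect_gr a h) (semidirect_br f) (semidirect_P f).
Proof.
split; first split.
- exact: semidirect_grading.
- move=> v c u w; rewrite ![semidirect_br f _ v]semidirect_brC.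
  exact: semidirect_linearr.
- exact: semidirect_linearr.
- move=> [x s]; congr pair => /=.
    (* The two action terms are both [f s x]. *)
    by rewrite (lie_alternating (qlie_lie (qaxiom a))) add0r addF2.
  exact: (lie_alternating (qlie_lie (qaxiom h))).
- exact: semidirect_jacobi.
- exact: semidirect_degree.
- exact: semidirect_P_degree.
- exact: semidirect_QL1.
- move=> n [x s] [y t] n1 /andP[x1 s1] /andP[y1 t1].
  exact: (semidirect_QL2 f n1).
Qed.
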